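(* For every integer $a>3$, $R_2(x+y+az=(a+1)w)=5$, where $x,y,z,w$ are the variables of the equation.
   Context: For a positive integer $N$ let $[N]=\{1,\dots,N\}$. For a linear homogeneous equation $\mathcal{E}$ with integer coefficients and a positive integer $c$, the Rado number $R_c(\mathcal{E})$ is the least positive integer $N$ such that every $c$-coloring of $[N]$ contains a monochromatic solution to $\mathcal{E}$, i.e. a solution whose variables all take values in $[N]$ (not necessarily distinct) having the same color. If no such $N$ exists, $R_c(\mathcal{E})=\infty$. *)

(* Defs.v *)
From mathcomp Require Import all_boot all_order all_algebra.
From mathcomp Require Import boolp.

Set Implicit Arguments.
Unset Strict Implicit.
Unset Printing Implicit Defensive.

Import GRing.Theory.
Local Open Scope ring_scope.

(* A linear homogeneous equation in n variables is the tuple E of its integer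
   coefficients, all moved to one side: tnth E 0 * v 0 + tnth E 1 * v 1 + ... = 0. *)
Definition solves (n : nat) (E : n.-tuple int) (v : 'I_n -> int) : bool :=
  \sum_(i < n) tnth E i * v i == 0.

(* The index type 'I_N = {0, ..., N-1} stands for [N] = {1, ..., N}: the element
   i of 'I_N represents the integer i + 1, hence the successor below. *)
Definition has_mono_solution (n : nat) (E : n.-tuple int) (N c : nat)
    (f : {ffun 'I_N -> 'I_c}) : bool :=
  [exists x : {ffun 'I_n -> 'I_N},
    solves E (fun i => (x i).+1%:Z) && [exists k, forall i, f (x i) == k]].

Definition rado_prop (c n : nat) (E : n.-tuple int) : pred nat :=
  fun N => (0 < N)%N && [forall f : {ffun 'I_N -> 'I_c}, has_mono_solution E f].

(* None encodes the value infinity. *)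
Definition rado_number (c n : nat) (E : n.-tuple int) : option nat :=
  if pselect (exists N, rado_prop c E N) is left exN then Some (ex_minn exN)
  else None.

(* Main.v *)
(* Putting w = z turns the equation into x + y = z, so the upper bound is the
   two-colour Schur number.  For the lower bound, colour [4] with classes {1, 4}
   and {2, 3}, which contain no solution of x + y = w.  A solution with z <> w
   satisfies x + y - w = a (w - z): if z > w, this needs x + y < w, impossible as
   w is then the smaller element of its class; if z < w, the right-hand side is
   at least 12, resp. 4, while the left-hand side is at most 4, resp. 3. *)
Require Import Defs.
From mathcomp Require Import all_boot all_order all_algebra.
From mathcomp Require Import boolp zify ring.

Import GRing.Theory.
Local Open Scope ring_scope.

Lemma ord2_neq_trans {a b c : 'I_2} : a != b -> b != c -> a = c.
Proof. by move: a b c => [[|[|?]] ?] [[|[|?]] ?] [[|[|?]] ?] // _ _; exact: val_inj. Qed.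

Lemma schur_2_5 (f : 'I_5 -> 'I_2) :
  exists i j k : 'I_5, [/\ (i.+1 + j.+1 = k.+1)%N, f i = f k & f j = f k].
Proof.
pose o n : 'I_5 := inord n.
(* [o n] is the integer n + 1. Avoiding 1 + 1 = 2 and 2 + 2 = 4 gives 1 and 4 the same colour;
   avoiding 1 + 4 = 5 and 1 + 3 = 4 then gives 3 and 5 the colour of 2, and 2 + 3 = 5 remains. *)
have [e01|n01] := eqVneq (f (o 0)) (f (o 1)).
  by exists (o 0), (o 0), (o 1); rewrite !inordK.
have [e13|n13] := eqVneq (f (o 1)) (f (o 3)).
  by exists (o 1), (o 1), (o 3); rewrite !inordK.
have e03 := ord2_neq_trans n01 n13.
have [e04|n04] := eqVneq (f (o 0)) (f (o 4)).
  by exists (o 0), (o 3), (o 4); rewrite !inordK // -e03.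
have [e02|n02] := eqVneq (f (o 0)) (f (o 2)).
  by exists (o 0), (o 2), (o 3); rewrite !inordK // -e02 -e03.
have e14 : f (o 1) = f (o 4) by apply: ord2_neq_trans n04; rewrite eq_sym.
have e24 : f (o 2) = f (o 4) by apply: ord2_neq_trans n04; rewrite eq_sym.
by exists (o 1), (o 2), (o 4); rewrite !inordK.
Qed.

Lemma solves4E (a b c d : int) (v : 'I_4 -> int) :
  solves [tuple a; b; c; d] v =
  (a * v (inord 0) + b * v (inord 1) + c * v (inord 2) + d * v (inord 3) == 0).
Proof.
rewrite /solves !big_ord_recr big_ord0 /= add0r !(tnth_nth 0) /=.
by congr (_ * v _ + _ * v _ + _ * v _ + _ * v _ == 0);
  apply: val_inj; rewrite /= inordK.
Qed.

Lemma rado_prop5 (a : int) : rado_prop 2 [tuple 1; 1; a; - (a + 1)] 5.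
Proof.
apply/andP; split=> //; apply/forallP => f.
have [i [j [k [eijk fik fjk]]]] := schur_2_5 f.
(* The default value [k] of [nth] fills both remaining positions, so z = w. *)
apply/existsP; exists [ffun t : 'I_4 => nth k [:: i; j] t].
apply/andP; split.
  rewrite solves4E !ffunE !inordK //=; apply/eqP.
  rewrite -eijk PoszD; ring.
apply/existsP; exists (f k); apply/forallP => t.
by rewrite ffunE; case: t => [[|[|[|[|t]]]] ht] //=; apply/eqP.
Qed.

Lemma no_mono_solution4 {a : int} {x y z w : nat} : 3 < a ->
    (x < 4)%N -> (y < 4)%N -> (z < 4)%N -> (w < 4)%N ->
    let red n := (n == 0%N) || (n == 3%N) in
    red x = red w -> red y = red w -> red z = red w ->
  1 * x.+1%:Z + 1 * y.+1%:Z + a * z.+1%:Z + - (a + 1) * w.+1%:Z != 0.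
Proof.
move=> ha hx hy hz hw red.
(* With z and w numerals, the products with [a] become linear, within reach of [lia]. *)
by move: z w hz hw => [|[|[|[|z]]]] [|[|[|[|w]]]] //= _ _;
  rewrite /red /=; lia.
Qed.

Lemma rado_prop_ge5 {a : int} {N : nat} : 3 < a ->
  rado_prop 2 [tuple 1; 1; a; - (a + 1)] N -> (5 <= N)%N.
Proof.
move=> ha /andP[_ /forallP hN]; rewrite leqNgt; apply/negP => ltN5.
(* Indices 0 and 3 are the integers 1 and 4. Restricting the colouring of [4] to [N] treats every N
   < 5 at once. *)
pose red n := (n == 0%N) || (n == 3%N).
have /existsP[x /andP[]] := hN [ffun i : 'I_N => inord (red i)].
rewrite solves4E => sol /existsP[k /forallP mono].
have colE t : (red (x t) : nat) = k.
  by have := mono t; rewrite ffunE => /eqP <-; rewrite inordK //; case: (red _).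
have lt4 t : (x t < 4)%N := leq_trans (ltn_ord (x t)) ltN5.
have same t u : red (x t) = red (x u).
  by have := colE t; rewrite -(colE u); do 2!case: (red _).
move: sol; apply/negP; exact: (no_mono_solution4 ha (lt4 _) (lt4 _) (lt4 _)
  (lt4 _) (same _ _) (same _ _) (same _ _)).
Qed.

Theorem theorem3p8 (a : int) (ha : 3 < a) :
  rado_number 2 [tuple 1; 1; a; - (a + 1)] = Some 5%N.
Proof.
rewrite /rado_number; case: pselect => [exN|[]]; last first.
  by exists 5%N; exact: rado_prop5.
congr Some; case: ex_minnP => m hm /(_ 5%N (rado_prop5 a)) le_m5.
by apply/eqP; rewrite eqn_leq le_m5 (rado_prop_ge5 ha hm).
Qed.
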